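(* Let $\Pi=\{\Pi^1,\dots,\Pi^N\}$ be a set of $N$ (pairwise) noncommuting observables with nondegenerate spectrum acting on a complex Hilbert space $\mathcal{H}_d$ with $\dim\mathcal{H}_d=d$, and let $Q(\Pi)$ be its incompatibility as defined in the context. Then $$Q(\Pi)\le\left(1-\frac1N\right)\left(1-\frac1d\right)\quad\text{if } N\le d+1,$$ $$Q(\Pi)\le\frac{d-1}{d+1}\quad\text{if } N\ge d+1.$$
   Context: Observables are Hermitian operators on $\mathcal{H}_d$; each has nondegenerate spectrum, so that it has an orthonormal eigenbasis unique up to phases and ordering. Let $|\psi^i_j\rangle$, $j=1,\dots,d$, be the normalized eigenvectors of $\Pi^i$ and let $\Pi^i_j=|\psi^i_j\rangle\langle\psi^i_j|$. The signal ensemble $S(\Pi)$ is the indexed family $\{\Pi^i_j\}_{i=1,\dots,N;\,j=1,\dots,d}$, each state having probability $1/(Nd)$ (the observables may share some eigenvectors). For a POVM $\mathbf{M}=\{M_a\}$ on $\mathcal{H}_d$ (finitely many positive semidefinite operators with $\sum_a M_a=\mathbb{I}$) and a state reconstruction map $\mathbf{A}:a\mapsto\sigma_a$ assigning to each outcome $a$ a density matrix $\sigma_a$ on $\mathcal{H}_d$, the average fidelity is $$F_{S(\Pi)}(\mathbf{M},\mathbf{A})=\frac{1}{Nd}\sum_{i,j,a}\mathrm{Tr}(\Pi^i_jM_a)\,\mathrm{Tr}(\Pi^i_j\sigma_a).$$ The optimal fidelity is $F_{S(\Pi)}=\sup_{\mathbf{M}}\sup_{\mathbf{A}}F_{S(\Pi)}(\mathbf{M},\mathbf{A})$,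 and the incompatibility of $\Pi$ is $Q(\Pi)=1-F_{S(\Pi)}$. *)

(* Defs.v *)
From HB Require Import structures.
From mathcomp Require Import all_boot all_order all_algebra.
From mathcomp Require Import complex.
From mathcomp Require Import boolp classical_sets reals.

Set Implicit Arguments.
Unset Strict Implicit.
Unset Printing Implicit Defensive.

Import Order.TTheory GRing.Theory Num.Theory.

Local Open Scope ring_scope.
Local Open Scope classical_set_scope.
Local Open Scope sesquilinear_scope.
Local Open Scope complex_scope.

(* With C := R[i], the Hilbert space H_d is 'cV[C]_d with <phi|psi> the entry of
   phi^t* *m psi; operators act by left multiplication on columns. *)

(* [eigenvalue] and [eigenspace] refer to row vectors, which changes neither
   the spectrum nor the dimensions of the eigenspaces. *)
Definition nondegenerate_spectrum (C : numClosedFieldType) (d : nat) (A : 'M[C]_d) : Prop :=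
  forall a : C, eigenvalue A a -> \rank (eigenspace A a) = 1%N.

Definition observable (C : numClosedFieldType) (d : nat) (A : 'M[C]_d) : Prop :=
  A \is hermsymmx /\ nondegenerate_spectrum A.

Definition orthonormal_eigenbasis (C : numClosedFieldType) (d : nat) (A : 'M[C]_d)
    (psi : 'I_d -> 'cV[C]_d) : Prop :=
  (forall j k : 'I_d, (psi j)^t* *m psi k = ((j == k)%:R)%:M) /\
  (forall j : 'I_d, exists a : C, A *m psi j = a *: psi j).

Lemma orthonormal_eigenbasis_exists (C : numClosedFieldType) (d : nat) (A : 'M[C]_d) :
  observable A -> exists psi, orthonormal_eigenbasis A psi.
Proof.
case=> /hermitian_normalmx /orthomx_spectralP.
set P := spectralmx A; set D := spectral_diag A => AE _.
have PU : P \is unitarymx by exact: spectral_unitarymx.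
have PPt : P *m P^t* = 1%:M by apply/unitarymxP.
have AP : A *m P^t* = P^t* *m diag_mx D.
  by rewrite {1}AE invmx_unitary // -[LHS]mulmxA PPt mulmx1.
exists (fun j => col j (P^t*)); split=> [j k|j].
  have -> : (col j (P^t*))^t* = row j P.
    by apply/matrixP=> x y; rewrite !mxE conjCK.
  apply/matrixP=> x y; rewrite !ord1 !mxE eqxx mulr1n.
  have /matrixP/(_ j k) := PPt; rewrite !mxE => <-.
  by apply: eq_bigr => l _; rewrite !mxE.
exists (D 0 j); rewrite !colE mulmxA AP -mulmxA scalemxAr; congr (_ *m _).
apply/matrixP=> x y; rewrite !mxE (bigD1 j) //= big1 => [|l lj].
  rewrite !mxE !eqxx /= addr0; case: eqVneq => [->|];
  by rewrite ?mulr1n ?mulr0n ?mul0r ?mulr0 ?mulr1.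
by rewrite !mxE (negPf lj) mulr0.
Qed.

Definition psdmx (C : numClosedFieldType) (d : nat) (A : 'M[C]_d) : Prop :=
  A \is hermsymmx /\ forall x : 'cV[C]_d, 0 <= (x^t* *m A *m x) 0 0.

Definition density_matrix (C : numClosedFieldType) (d : nat) (A : 'M[C]_d) : Prop :=
  psdmx A /\ \tr A = 1.

Definition povm (C : numClosedFieldType) (d k : nat) (M : 'I_k -> 'M[C]_d) : Prop :=
  (forall a, psdmx (M a)) /\ \sum_a M a = 1%:M.

Definition reconstruction (C : numClosedFieldType) (d k : nat)
    (sigma : 'I_k -> 'M[C]_d) : Prop :=
  forall a, density_matrix (sigma a).

Definition projector (C : numClosedFieldType) (d : nat) (v : 'cV[C]_d) : 'M[C]_d :=
  v *m v^t*.

(* The traces are real when [M] is a POVM and [sigma] a reconstruction, so that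
   the real part only changes the type. *)
Definition average_fidelity (R : realType) (N d k : nat)
    (psi : 'I_N -> 'I_d -> 'cV[R[i]]_d) (M sigma : 'I_k -> 'M[R[i]]_d) : R :=
  (N%:R * d%:R)^-1 *
  \sum_(i < N) \sum_(j < d) \sum_(a < k)
    complex.Re (\tr (projector (psi i j) *m M a) *
                \tr (projector (psi i j) *m sigma a)).

Definition optimal_reconstruction_fidelity (R : realType) (N d k : nat)
    (psi : 'I_N -> 'I_d -> 'cV[R[i]]_d) (M : 'I_k -> 'M[R[i]]_d) : R :=
  sup [set f : R | exists sigma : 'I_k -> 'M[R[i]]_d,
         reconstruction sigma /\ f = average_fidelity psi M sigma].

(* The number [k] of outcomes of the POVM is part of the supremum. *)
Definition optimal_fidelity (R : realType) (N d : nat)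
    (psi : 'I_N -> 'I_d -> 'cV[R[i]]_d) : R :=
  sup [set f : R | exists (k : nat) (M : 'I_k -> 'M[R[i]]_d),
         povm M /\ f = optimal_reconstruction_fidelity psi M].

(* For observables Pi^i, [psi i] is to be an orthonormal eigenbasis of Pi^i.
   The value does not depend on which one, since the spectrum of Pi^i is
   nondegenerate: another choice permutes the projectors [projector (psi i j)]
   for each [i]. *)
Definition incompatibility (R : realType) (N d : nat)
    (psi : 'I_N -> 'I_d -> 'cV[R[i]]_d) : R :=
  1 - optimal_fidelity psi.

(* Main.v *)
(* Each bound comes from one measure-and-guess strategy.  Measuring in the
   eigenbasis of one observable and guessing the observed eigenvector is perfect
   on that eigenbasis; on every other one Cauchy-Schwarz gives fidelity at least
   1/d.  The average is at least 1/N + 1/d - 1/(N d).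

   The other strategy measures a finite weighted complex projective 2-design: the
   standard basis with total weight 1/(d+1), and the 4^d vectors with entries
   i^(f a) / sqrt d with total weight d/(d+1).  For a unit vector x, the first part
   contributes sum |x_a|^4 / (d+1); since the average over f of
   |sum_a x_a i^(f a)|^4 is 2 - sum |x_a|^4, the second contributes
   (2 - sum |x_a|^4) / (d+1).  The total is 2/(d+1), whatever x is. *)

Require Import Defs.
From mathcomp Require Import all_boot all_order all_algebra.
From mathcomp Require Import complex.
From mathcomp Require Import boolp classical_sets reals.
From mathcomp Require Import ring.

Import Order.TTheory GRing.Theory Num.Theory.

Local Open Scope classical_set_scope.
Local Open Scope sesquilinear_scope.
Local Open Scope ring_scope.
Local Open Scope complex_scope.

(** * Averages over phases that are fourth roots of unity *)

Lemma fourth_roots_moment1 (C : numClosedFieldType) (y : C) :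
  \sum_(k < 4) y * 'i ^+ k = 0.
Proof.
have ii : 'i ^+ 2 = -1 :> C := sqrCi C.
rewrite !big_ord_recl big_ord0 /= /bump /= !add1n expr0 expr1 !exprS expr0.
by ring: ii.
Qed.

Lemma fourth_roots_moment2 (C : numClosedFieldType) (s y : C) :
  \sum_(k < 4) `|s + y * 'i ^+ k| ^+ 2 = 4 * (`|s| ^+ 2 + `|y| ^+ 2).
Proof.
have ii : 'i ^+ 2 = -1 :> C := sqrCi C.
rewrite !big_ord_recl big_ord0 /= /bump /= !add1n !normCK.
rewrite !rmorphD !rmorphM !rmorphXn /= conjCi.
by ring: ii.
Qed.

(** Put p = |s|^2 and q = |y|^2. The squared modulus is p + q plus a cross term that sums to zero
    over k; the square of the cross term is 2 p q plus a multiple of (-1)^k, which also cancels. The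
    signs 1 and -1 alone would not cancel it. *)
Lemma fourth_roots_moment4 (C : numClosedFieldType) (s y : C) :
  \sum_(k < 4) (`|s + y * 'i ^+ k| ^+ 2) ^+ 2 =
  4 * ((`|s| ^+ 2) ^+ 2 + 4 * (`|s| ^+ 2 * `|y| ^+ 2) + (`|y| ^+ 2) ^+ 2).
Proof.
have ii : 'i ^+ 2 = -1 :> C := sqrCi C.
rewrite !big_ord_recl big_ord0 /= /bump /= !add1n !normCK.
rewrite !rmorphD !rmorphM !rmorphXn /= conjCi.
by ring: ii.
Qed.

(** Addition on ['I_4] is that of Z/4, so adding this function to [f] rotates the phase at [a] alone
    by i^k. *)
Definition shift_at {J : finType} (a : J) (k : 'I_4) : {ffun J -> 'I_4} :=
  [ffun b => if b == a then k else 0].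

(** Translations permute the phase functions, so a sum over all of them may first be averaged over
    the phase at [a]. *)
Lemma sum_shift_at (V : zmodType) (J : finType) (a : J)
    (F : {ffun J -> 'I_4} -> V) :
  (\sum_(f : {ffun _ -> 'I_4}) F f) *+ 4 = \sum_(f : {ffun _ -> 'I_4}) \sum_(k < 4) F (f + shift_at a k).
Proof.
transitivity (\sum_(k < 4) \sum_f F f); first by rewrite sumr_const card_ord.
rewrite [RHS]exchange_big; apply: eq_bigr => k _.
have inj : injective (fun f : {ffun J -> 'I_4} => f + shift_at a k) by move=> f g /addIr.
by rewrite (reindex_inj inj).
Qed.

Definition phase (C : numClosedFieldType) {J : finType} (f : {ffun J -> 'I_4}) (a : J) : C :=
  'i ^+ f a.

Lemma phase_shift_at (C : numClosedFieldType) (J : finType) (f : {ffun J -> 'I_4})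
    (a : J) (k : 'I_4) :
  phase C (f + shift_at a k) a = phase C f a * 'i ^+ k.
Proof.
(* The exponent is reduced modulo 4, which is harmless because i^4 = 1. *)
rewrite /phase !ffunE eqxx /= expr_mod ?exprD //.
by rewrite -[4%N]/(2 * 2)%N exprM sqrCi sqrrN expr1n.
Qed.

Lemma phase_shift_at_neq (C : numClosedFieldType) (J : finType) (f : {ffun J -> 'I_4})
    (a b : J) (k : 'I_4) :
  b != a -> phase C (f + shift_at a k) b = phase C f b.
Proof. by move=> /negPf ba; rewrite /phase !ffunE ba addr0. Qed.

Lemma norm_phase (C : numClosedFieldType) (J : finType) (f : {ffun J -> 'I_4}) (a : J) :
  `|phase C f a| = 1.
Proof. by rewrite /phase normrX normCi expr1n. Qed.

(** For a != b, rotating the phase at [a] multiplies the summand by i^k, and these sum to zero. This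
    makes the phase vectors resolve the identity. *)
Lemma sum_phase_conj (C : numClosedFieldType) (J : finType) (a b : J) :
  \sum_(f : {ffun _ -> 'I_4}) phase C f a * (phase C f b)^* = (4 ^ #|J|)%:R * (a == b)%:R.
Proof.
case: eqVneq => [->|ab].
  rewrite (eq_bigr (fun=> 1)) => [|f _]; last by rewrite -normCK norm_phase expr1n.
  by rewrite sumr_const card_ffun card_ord mulr1.
rewrite mulr0; apply: (@pmulrnI C 4) => //.
rewrite mul0rn (@sum_shift_at _ _ a) big1 // => f _.
rewrite (eq_bigr (fun k : 'I_4 => phase C f a * (phase C f b)^* * 'i ^+ k)).
  exact: fourth_roots_moment1.
by move=> k _; rewrite phase_shift_at phase_shift_at_neq 1?eq_sym // mulrAC.
Qed.

(* Induction on [r]: with q = |x a|^2 and p the sum of |x b|^2 over the tail,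
   averaging over the phase at [a] adds 4 p q + q^2 to the fourth moment, which is
   the increment of 2 p^2 - sum |x b|^4. *)
Lemma sum_phase_moments (C : numClosedFieldType) (J : finType) (x : J -> C) (r : seq J) :
  uniq r ->
  \sum_(f : {ffun _ -> 'I_4}) `|\sum_(a <- r) x a * phase C f a| ^+ 2 =
    (4 ^ #|J|)%:R * \sum_(a <- r) `|x a| ^+ 2 /\
  \sum_(f : {ffun _ -> 'I_4}) (`|\sum_(a <- r) x a * phase C f a| ^+ 2) ^+ 2 =
    (4 ^ #|J|)%:R * (2 * (\sum_(a <- r) `|x a| ^+ 2) ^+ 2 -
                     \sum_(a <- r) (`|x a| ^+ 2) ^+ 2).
Proof.
elim: r => [_|a r IH /= /andP[ar /IH[IH2 IH4]]].
  split; rewrite !big_nil ?expr0n /= !mulr0 ?subr0 ?mulr0.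
    by apply: big1 => f _; rewrite big_nil normr0 expr0n.
  by apply: big1 => f _; rewrite big_nil normr0 !expr0n.
have tail f k : \sum_(b <- r) x b * phase C (f + shift_at a k) b =
                \sum_(b <- r) x b * phase C f b.
  apply: eq_big_seq => b br; rewrite phase_shift_at_neq //.
  by apply: contraNneq ar => <-.
have head f : `|x a * phase C f a| = `|x a| by rewrite normrM norm_phase mulr1.
split; apply: (@pmulrnI _ 4) => //; rewrite (@sum_shift_at _ _ a).
  transitivity (\sum_(f : {ffun _ -> 'I_4}) 4 * (`|\sum_(b <- r) x b * phase C f b| ^+ 2 + `|x a| ^+ 2)).
    apply: eq_bigr => f _; rewrite -(head f) -fourth_roots_moment2.
    apply: eq_bigr => k _.
    by rewrite big_cons tail phase_shift_at mulrA addrC.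
  rewrite -mulr_sumr big_split /= IH2 sumr_const card_ffun card_ord big_cons.
  by ring.
transitivity (\sum_(f : {ffun _ -> 'I_4}) 4 * ((`|\sum_(b <- r) x b * phase C f b| ^+ 2) ^+ 2 +
   4 * (`|\sum_(b <- r) x b * phase C f b| ^+ 2 * `|x a| ^+ 2) + (`|x a| ^+ 2) ^+ 2)).
  apply: eq_bigr => f _; rewrite -(head f) -fourth_roots_moment4.
  apply: eq_bigr => k _.
  by rewrite big_cons tail phase_shift_at mulrA addrC.
rewrite -mulr_sumr !big_split /= IH4 -mulr_sumr -mulr_suml IH2.
rewrite sumr_const card_ffun card_ord !big_cons.
by ring.
Qed.

(** * Projectors, overlaps and orthonormal bases *)

Lemma adjmxM (C : numClosedFieldType) (m n p : nat) (A : 'M[C]_(m, n)) (B : 'M[C]_(n, p)) :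
  (A *m B)^t* = B^t* *m A^t*.
Proof. by rewrite trmx_mul map_mxM. Qed.

Definition overlap {C : numClosedFieldType} {d : nat} (u v : 'cV[C]_d) : C :=
  `|(u^t* *m v) 0 0| ^+ 2.

Lemma overlap_ge0 (C : numClosedFieldType) (d : nat) (u v : 'cV[C]_d) : 0 <= overlap u v.
Proof. exact: exprn_ge0. Qed.

Lemma tr_projector_mul (C : numClosedFieldType) (d : nat) (u : 'cV[C]_d) (A : 'M[C]_d) :
  \tr (projector u *m A) = (u^t* *m A *m u) 0 0.
Proof. by rewrite /projector -mulmxA mxtrace_mulC [LHS]big_ord1. Qed.

Lemma projector_form (C : numClosedFieldType) (d : nat) (u v : 'cV[C]_d) :
  (u^t* *m projector v *m u) 0 0 = overlap u v.
Proof.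
have vu : v^t* *m u = (u^t* *m v)^t* by rewrite adjmxM trmxCK.
by rewrite /projector mulmxA -mulmxA vu [LHS]mxE big_ord1 !mxE /overlap normCK !mxE.
Qed.

Lemma tr_projector_scale (C : numClosedFieldType) (d : nat) (u v : 'cV[C]_d) (m : C) :
  \tr (projector u *m (m *: projector v)) = m * overlap u v.
Proof. by rewrite -scalemxAr mxtraceZ tr_projector_mul projector_form. Qed.

Lemma tr_projector (C : numClosedFieldType) (d : nat) (v : 'cV[C]_d) :
  \tr (projector v) = (v^t* *m v) 0 0.
Proof. by rewrite /projector mxtrace_mulC [LHS]big_ord1. Qed.

Lemma psdmx_scale_projector (C : numClosedFieldType) (d : nat) (v : 'cV[C]_d) (m : C) :
  0 <= m -> psdmx (m *: projector v).
Proof.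
move=> m0; split=> [|x].
  apply/is_hermitianmxP; rewrite expr0 scale1r linearZ /= map_mxZ.
  rewrite /projector adjmxM trmxCK; congr (_ *: _).
  exact/esym/CrealP/ger0_real.
by rewrite -scalemxAr -scalemxAl mxE projector_form mulr_ge0 ?overlap_ge0.
Qed.

Definition orthonormal {C : numClosedFieldType} {d : nat} (psi : 'I_d -> 'cV[C]_d) : Prop :=
  forall j k, (psi j)^t* *m psi k = ((j == k)%:R)%:M.

(** Orthonormality is U^* U = 1 for the matrix U with columns [psi]; as U is square, also U U^* =
    1. *)
Lemma sum_projector (C : numClosedFieldType) (d : nat) (psi : 'I_d -> 'cV[C]_d) :
  orthonormal psi -> \sum_j projector (psi j) = 1%:M.
Proof.
move=> psiO; pose U := \matrix_(j, k) psi k j 0.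
have : U^t* *m U = 1%:M.
  apply/matrixP => j k; rewrite !mxE; transitivity (((psi j)^t* *m psi k) 0 0).
    by rewrite mxE; apply: eq_bigr => l _; rewrite !mxE.
  by rewrite psiO mxE eqxx mulr1n.
move=> /mulmx1C <-; apply/matrixP => j k; rewrite summxE mxE.
by apply: eq_bigr => l _; rewrite !mxE big_ord1 !mxE.
Qed.

Lemma overlap_orthonormal (C : numClosedFieldType) (d : nat) (psi : 'I_d -> 'cV[C]_d) j k :
  orthonormal psi -> overlap (psi j) (psi k) = (j == k)%:R.
Proof.
move=> psiO; rewrite /overlap psiO mxE eqxx mulr1n.
by case: (j == k); rewrite ?normr1 ?normr0 ?expr1n ?expr0n.
Qed.

(** Parseval's identity. *)
Lemma sum_overlap (C : numClosedFieldType) (d : nat) (psi : 'I_d -> 'cV[C]_d) (v : 'cV[C]_d) :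
  orthonormal psi -> \sum_j overlap (psi j) v = (v^t* *m v) 0 0.
Proof.
move=> psiO; rewrite -tr_projector -[projector v]mul1mx -(sum_projector _ _ _ psiO).
rewrite mulmx_suml raddf_sum; apply: eq_bigr => j _.
by rewrite /= -[in RHS](scale1r (projector v)) tr_projector_scale mul1r.
Qed.

Lemma psdmx_tr_projector_ge0 (C : numClosedFieldType) (d : nat) (A : 'M[C]_d) (u : 'cV[C]_d) :
  psdmx A -> 0 <= \tr (projector u *m A).
Proof. by case=> _ A0; rewrite tr_projector_mul. Qed.

Lemma density_tr_projector_le1 (C : numClosedFieldType) (d : nat) (A : 'M[C]_d)
    (psi : 'I_d -> 'cV[C]_d) j :
  orthonormal psi -> density_matrix A -> \tr (projector (psi j) *m A) <= 1.
Proof.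
move=> psiO [A0 <-]; rewrite -[in leRHS](mul1mx A) -(sum_projector _ _ _ psiO).
rewrite mulmx_suml raddf_sum (bigD1 j) //= lerDl.
by apply: sumr_ge0 => k _; apply: psdmx_tr_projector_ge0.
Qed.

(** With the real part outside, sums can be estimated in [R[i]], whose partial order compares real
    parts when the imaginary parts agree. *)
Lemma average_fidelityE (R : realType) (N d k : nat)
    (psi : 'I_N -> 'I_d -> 'cV[R[i]]_d) (M sigma : 'I_k -> 'M[R[i]]_d) :
  average_fidelity psi M sigma = (N%:R * d%:R)^-1 *
  complex.Re (\sum_(i < N) \sum_(j < d) \sum_(a < k)
    \tr (projector (psi i j) *m M a) * \tr (projector (psi i j) *m sigma a)).
Proof.
rewrite /average_fidelity; congr (_ * _); rewrite raddf_sum; apply: eq_bigr => i _.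
rewrite raddf_sum; apply: eq_bigr => j _.
by rewrite raddf_sum.
Qed.

(** * Any single strategy bounds the optimal fidelity from below *)

Section Fidelity.
Context {R : realType} {N d : nat} (psi : 'I_N -> 'I_d -> 'cV[R[i]]_d).
Hypotheses (N0 : (0 < N)%N) (d0 : (0 < d)%N) (psiO : forall i, orthonormal (psi i)).

Let Nd0 : 0 < N%:R * d%:R :> R.
Proof. by rewrite mulr_gt0 ?ltr0n. Qed.

Lemma average_fidelity_le1 (k : nat) (M sigma : 'I_k -> 'M[R[i]]_d) :
  povm M -> reconstruction sigma -> average_fidelity psi M sigma <= 1.
Proof.
move=> [M0 M1] sigmaD; rewrite average_fidelityE ler_pdivrMl // mulr1.
suff : \sum_(i < N) \sum_(j < d) \sum_(a < k)
    \tr (projector (psi i j) *m M a) * \tr (projector (psi i j) *m sigma a)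
    <= (N%:R * d%:R)%:C by rewrite lecE => /andP[].
have -> : (N%:R * d%:R)%:C = \sum_(i < N) \sum_(j < d) 1 :> R[i].
  rewrite !sumr_const !card_ord rmorphM /= !rmorph_nat.
  by rewrite mulr_natl.
apply: ler_sum => i _; apply: ler_sum => j _.
(* The outcome probabilities add up to 1, and each is multiplied by a guess fidelity of at most
   1. *)
have <- : \sum_a \tr (projector (psi i j) *m M a) = 1.
  rewrite -raddf_sum -mulmx_sumr M1 mulmx1 /= tr_projector psiO.
  by rewrite mxE !eqxx.
apply: ler_sum => a _; apply: ler_piMr; first exact: psdmx_tr_projector_ge0.
exact: density_tr_projector_le1.
Qed.

Lemma optimal_reconstruction_fidelity_le1 (k : nat) (M : 'I_k -> 'M[R[i]]_d) :
  povm M -> optimal_reconstruction_fidelity psi M <= 1.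
Proof.
move=> MP; rewrite /optimal_reconstruction_fidelity.
(* By convention [sup] of the empty set is 0, which satisfies the bound too. *)
set E := (X in sup X); have [->|/set0P E0] := eqVneq E set0; first by rewrite sup0.
by apply: ge_sup => // _ [sigma [sD ->]]; apply: average_fidelity_le1.
Qed.

(** Both suprema range over sets bounded by 1, hence dominate their elements. *)
Lemma average_fidelity_le_optimal (k : nat) (M sigma : 'I_k -> 'M[R[i]]_d) :
  povm M -> reconstruction sigma -> average_fidelity psi M sigma <= optimal_fidelity psi.
Proof.
move=> MP sD; apply: (@le_trans _ _ (optimal_reconstruction_fidelity psi M)).
  apply: ub_le_sup; last by exists sigma.
  by exists 1 => _ [tau [tD ->]]; apply: average_fidelity_le1.
apply: ub_le_sup; last by exists k, M.
by exists 1 => _ [l [M' [M'P ->]]]; apply: optimal_reconstruction_fidelity_le1.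
Qed.

(* The vectors [v t] are not normalized: [m t] is the weight of the outcome [t] in
   the POVM, and [s t] normalizes the guessed state. *)
Lemma le_optimal_fidelity (T : finType) (m s : T -> R[i]) (v : T -> 'cV[R[i]]_d) (r : R) :
    (forall t, 0 <= m t) -> (forall t, 0 <= s t) ->
    (forall t, s t * ((v t)^t* *m v t) 0 0 = 1) ->
    \sum_t m t *: projector (v t) = 1%:M ->
    N%:R * d%:R * r%:C <=
      \sum_i \sum_j \sum_t m t * s t * overlap (psi i j) (v t) ^+ 2 ->
  r <= optimal_fidelity psi.
Proof.
move=> m0 s0 sv mv rle.
pose M a := m (@enum_val T T a) *: projector (v (enum_val a)).
pose sigma a := s (@enum_val T T a) *: projector (v (enum_val a)).
have MP : povm M.
  split=> [a|]; first exact: psdmx_scale_projector.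
  by rewrite -mv -(big_enum_val (fun t => m t *: projector (v t))).
have sD : reconstruction sigma.
  move=> a; split; first exact: psdmx_scale_projector.
  by rewrite mxtraceZ tr_projector sv.
apply: le_trans (average_fidelity_le_optimal _ _ _ MP sD).
rewrite average_fidelityE ler_pdivlMl //.
have : (N%:R * d%:R * r)%:C <= \sum_(i < N) \sum_(j < d) \sum_(a < #|T|)
    \tr (projector (psi i j) *m M a) * \tr (projector (psi i j) *m sigma a).
  rewrite !rmorphM /= !rmorph_nat; apply: le_trans rle _.
  rewrite le_eqVlt; apply/orP; left; apply/eqP.
  apply: eq_bigr => i _; apply: eq_bigr => j _.
  rewrite (big_enum_val (fun t => m t * s t * overlap (psi i j) (v t) ^+ 2)).
  apply: eq_bigr => a _; rewrite !tr_projector_scale.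
  by rewrite expr2 mulrACA.
by rewrite lecE => /andP[].
Qed.

End Fidelity.

(** * Measuring in one eigenbasis *)

Lemma sum_sqr_ge (C : numClosedFieldType) (n : nat) (p : 'I_n -> C) :
  (0 < n)%N -> (forall j, p j \is Num.real) -> \sum_j p j = 1 ->
  n%:R^-1 <= \sum_j p j ^+ 2.
Proof.
move=> n0 pR p1; have nz : n%:R != 0 :> C by rewrite pnatr_eq0 -lt0n.
(* Expanding the squared deviations from the uniform distribution gives the bound. *)
have : 0 <= \sum_j (p j - n%:R^-1) ^+ 2.
  by apply: sumr_ge0 => j _; rewrite real_exprn_even_ge0 // rpredB // rpredV rpred_nat.
suff -> : \sum_j (p j - n%:R^-1) ^+ 2 = \sum_j p j ^+ 2 - n%:R^-1 by rewrite subr_ge0.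
transitivity (\sum_j p j ^+ 2 - 2 / n%:R * \sum_j p j + \sum_(j < n) n%:R^-1 ^+ 2).
  rewrite mulr_sumr -sumrB -big_split; apply: eq_bigr => j _ /=.
  by ring.
rewrite p1 sumr_const card_ord -mulr_natl.
by field.
Qed.

Lemma optimal_fidelity_ge_basis (R : realType) (N d : nat)
    (psi : 'I_N -> 'I_d -> 'cV[R[i]]_d) :
  (0 < N)%N -> (0 < d)%N -> (forall i, orthonormal (psi i)) ->
  N%:R^-1 + d%:R^-1 - (N%:R * d%:R)^-1 <= optimal_fidelity psi.
Proof.
move=> N0 d0 psiO; pose i0 := Ordinal N0.
apply: (@le_optimal_fidelity _ _ _ psi N0 d0 psiO 'I_d (fun=> 1) (fun=> 1) (psi i0)) => //.
- by move=> t; rewrite psiO mxE !eqxx mulr1.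
- by under eq_bigr do rewrite scale1r; rewrite sum_projector.
have Nz : N%:R != 0 :> R[i] by rewrite pnatr_eq0 -lt0n.
have dz : d%:R != 0 :> R[i] by rewrite pnatr_eq0 -lt0n.
rewrite rmorphB rmorphD /= !fmorphV rmorphM /= !rmorph_nat.
(* The total N + d - 1 is split by basis: d for the measured one, 1 for each other. *)
have -> : N%:R * d%:R * (N%:R^-1 + d%:R^-1 - (N%:R * d%:R)^-1) =
    \sum_(i < N) (1 + (i == i0)%:R * (d%:R - 1)) :> R[i].
  rewrite big_split /= sumr_const card_ord -mulr_suml (bigD1 i0) //= big1.
    by field; rewrite Nz dz.
  by move=> i /negPf ->.
apply: ler_sum => i _; rewrite exchange_big /=.
have [->|_] := eqVneq i i0.
  rewrite mulr1n mul1r addrC subrK le_eqVlt; apply/orP; left; apply/eqP.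
  rewrite (eq_bigr (fun=> 1)) => [|a _]; first by rewrite sumr_const card_ord.
  rewrite (bigD1 a) //= big1 => [|j /negPf ja].
    by rewrite overlap_orthonormal // eqxx !mul1r expr1n addr0.
  by rewrite overlap_orthonormal // ja expr0n mulr0.
rewrite mul0r addr0.
(* For each outcome [a], the overlaps with the basis [psi i] form a probability distribution, so
   their squares add up to at least 1/d. *)
have {1}-> : 1 = \sum_(a < d) d%:R^-1 :> R[i].
  by rewrite sumr_const card_ord -[RHS]mulr_natl divff.
apply: ler_sum => a _; under eq_bigr => j _ do rewrite !mul1r.
apply: sum_sqr_ge => // [j|]; first exact/ger0_real/overlap_ge0.
by rewrite sum_overlap // psiO mxE !eqxx.
Qed.

(** * Measuring a weighted 2-design *)

Lemma optimal_fidelity_ge_design (R : realType) (N d : nat)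
    (psi : 'I_N -> 'I_d -> 'cV[R[i]]_d) :
  (0 < N)%N -> (0 < d)%N -> (forall i, orthonormal (psi i)) ->
  2 / (d%:R + 1) <= optimal_fidelity psi.
Proof.
move=> N0 d0 psiO.
have Dz : d%:R != 0 :> R[i] by rewrite pnatr_eq0 -lt0n.
have D1z : d%:R + 1 != 0 :> R[i] by rewrite natr1 pnatr_eq0.
have Kz : (4 ^ d)%:R != 0 :> R[i] by rewrite pnatr_eq0 expn_eq0.
(* The design weights are multiplied by d, the trace of the identity. The phase vectors have squared
   norm d, which cancels this factor in [m] and gives the 1/d in [s]. *)
pose m (t : 'I_d + {ffun 'I_d -> 'I_4}) : R[i] :=
  if t is inl _ then (d%:R + 1)^-1 else d%:R / (d%:R + 1) / (4 ^ d)%:R.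
pose s (t : 'I_d + {ffun 'I_d -> 'I_4}) : R[i] := if t is inl _ then 1 else d%:R^-1.
pose v (t : 'I_d + {ffun 'I_d -> 'I_4}) : 'cV[R[i]]_d :=
  match t with inl a => delta_mx a 0 | inr f => \col_a phase R[i] f a end.
apply: (@le_optimal_fidelity _ _ _ psi N0 d0 psiO _ m s v).
- by case=> [a|f] /=; rewrite ?divr_ge0 ?invr_ge0 ?addr_ge0 ?ler0n.
- by case=> [a|f] /=; rewrite ?invr_ge0 ?ler01 ?ler0n.
- case=> [a|f] /=; rewrite -tr_projector /projector /mxtrace.
    rewrite (bigD1 a) //= big1 => [|b /negPf ba].
      by rewrite !mxE big_ord1 !mxE !eqxx /= mulr1n conjC1 addr0 !mulr1.
    by rewrite !mxE big_ord1 !mxE ba mul0r.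
  rewrite (eq_bigr (fun=> 1)) => [|a _].
    by rewrite sumr_const card_ord mulVf.
  by rewrite !mxE big_ord1 !mxE -normCK norm_phase expr1n.
(* On the diagonal the two families contribute 1/(d+1) and d/(d+1); off it both vanish. *)
- rewrite big_sumType /=; apply/matrixP => a b; rewrite !mxE !summxE.
  rewrite (bigD1 a) //= big1 => [|c ca]; last first.
    by rewrite !mxE big_ord1 !mxE (eq_sym a) (negPf ca) mul0r mulr0.
  rewrite !mxE big_ord1 !mxE !eqxx /= mulr1n mul1r addr0.
  under eq_bigr do rewrite !mxE big_ord1 !mxE.
  rewrite -mulr_sumr sum_phase_conj card_ord andbT (eq_sym b).
  by case: (a == b); rewrite ?conjC1 ?conjC0 /=; field; rewrite Kz D1z.
rewrite natr1 fmorph_div /= !rmorph_nat -[d.+1%:R]natr1.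
rewrite (eq_bigr (fun=> d%:R * (2 / (d%:R + 1)))) => [|i _].
  by rewrite sumr_const card_ord -[leRHS]mulr_natl -mulrA.
rewrite (eq_bigr (fun=> 2 / (d%:R + 1))) => [|j _].
  by rewrite sumr_const card_ord -[LHS]mulr_natl.
(* The coordinates are conjugated because [overlap] is conjugate-linear in its first vector before
   the modulus is taken. *)
pose x a := (psi i j a 0)^*%R.
have x1 : \sum_a `|x a| ^+ 2 = 1.
  transitivity (((psi i j)^t* *m psi i j) 0 0).
    rewrite mxE; apply: eq_bigr => a _.
    by rewrite !mxE normCK conjCK.
  by rewrite psiO mxE !eqxx.
have [_ E4] := sum_phase_moments _ _ x _ (index_enum_uniq 'I_d).
rewrite big_sumType /=.
under eq_bigr => a _.
  rewrite (_ : overlap _ _ = `|x a| ^+ 2); last first.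
    rewrite /overlap mxE (bigD1 a) //= big1 => [|b /negPf ba].
      by rewrite !mxE !eqxx /= mulr1n mulr1 addr0.
    by rewrite !mxE ba mulr0.
  over.
under [X in _ + X]eq_bigr => f _.
  rewrite (_ : overlap _ _ = `|\sum_a x a * phase R[i] f a| ^+ 2); last first.
    by rewrite /overlap mxE; congr (`|_| ^+ 2); apply: eq_bigr => a _; rewrite !mxE.
  over.
rewrite -!mulr_sumr E4 x1 card_ord.
by field; rewrite Kz Dz D1z.
Qed.

Theorem theorem1 (R : realType) (N d : nat) (hN : (0 < N)%N) (hd : (0 < d)%N)
    (Pi : 'I_N -> 'M[R[i]]_d)
    (hobs : forall i : 'I_N, observable (Pi i))
    (hcomm : forall i i' : 'I_N, i != i' -> Pi i *m Pi i' <> Pi i' *m Pi i)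
    (psi : 'I_N -> 'I_d -> 'cV[R[i]]_d)
    (hpsi : forall i : 'I_N, orthonormal_eigenbasis (Pi i) (psi i)) :
  ((N <= d + 1)%N ->
     incompatibility psi <= (1 - N%:R^-1) * (1 - d%:R^-1)) /\
  ((d + 1 <= N)%N ->
     incompatibility psi <= (d%:R - 1) / (d%:R + 1)).
Proof.
have psiO i : orthonormal (psi i) by case: (hpsi i).
have Nz : N%:R != 0 :> R by rewrite pnatr_eq0 -lt0n.
have dz : d%:R != 0 :> R by rewrite pnatr_eq0 -lt0n.
have d1z : d%:R + 1 != 0 :> R by rewrite natr1 pnatr_eq0.
(* The claims turn into the lower bounds 1/N + 1/d - 1/(N d) and 2/(d+1) on the optimal fidelity. *)
split=> _; rewrite /incompatibility lerBlDr -lerBlDl.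
  apply: le_trans (optimal_fidelity_ge_basis _ _ _ _ hN hd psiO).
  rewrite le_eqVlt; apply/orP; left; apply/eqP.
  by field; rewrite Nz dz.
apply: le_trans (optimal_fidelity_ge_design _ _ _ _ hN hd psiO).
rewrite le_eqVlt; apply/orP; left; apply/eqP.
by field.
Qed.
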